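(* Let $G$ be a minimally 2-connected graph with $m$ edges. (i) If $m$ is even, then $\rho(G)\le \sqrt{m}$, with equality if and only if $G\cong K_{2,m/2}$. (ii) If $m$ is odd and $m\ge 9$, then $\rho(G)\le \rho_1^*(m)$, where $\rho_1^*(m)$ is the largest root of $x^3-x^2-(m-2)x+m-3=0$, with equality if and only if $G\cong SK_{2,\frac{m-1}{2}}$.
   Context: All graphs are finite and simple. The size of a graph is its number of edges. $\rho(G)$ denotes the spectral radius of $G$, i.e. the largest eigenvalue of its adjacency matrix. A graph is minimally 2-connected if it is 2-connected but deleting any one edge leaves a graph that is not 2-connected. $K_{a,b}$ is the complete bipartite graph. For odd $m$, $SK_{2,\frac{m-1}{2}}$ denotes the graph obtained from $K_{2,\frac{m-1}{2}}$ by subdividing one edge once (replacing one edge $xy$ by a path $xzy$ through a new vertex $z$); it has $m$ edges. *)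

(* Defs.v *)
From mathcomp Require Import all_boot all_order all_algebra.
From mathcomp Require Import boolp classical_sets reals.
Set Implicit Arguments. Unset Strict Implicit. Unset Printing Implicit Defensive.
Import Order.TTheory GRing.Theory Num.Theory.

Definition simple_graph n (e : rel 'I_n) : Prop := symmetric e /\ irreflexive e.

Definition gsize n (e : rel 'I_n) : nat :=
  #|[set p : 'I_n * 'I_n | (p.1 < p.2)%N && e p.1 p.2]|.

Definition connected_in n (e : rel 'I_n) (S : {set 'I_n}) : Prop :=
  forall x y, x \in S -> y \in S ->
    connect (fun a b => [&& e a b, a \in S & b \in S]) x y.

Definition two_connected n (e : rel 'I_n) : Prop :=
  [/\ (2 < n)%N, connected_in e [set: 'I_n]%SET & forall v, connected_in e (~: [set v])%SET].

Definition del_edge n (e : rel 'I_n) (x y : 'I_n) : rel 'I_n :=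
  fun a b => e a b && ~~ (((a == x) && (b == y)) || ((a == y) && (b == x))).

Definition minimally_two_connected n (e : rel 'I_n) : Prop :=
  two_connected e /\ forall x y, e x y -> ~ two_connected (del_edge e x y).

Definition graph_iso n n' (e : rel 'I_n) (e' : rel 'I_n') : Prop :=
  exists f : 'I_n -> 'I_n', bijective f /\ forall x y, e' (f x) (f y) = e x y.

Definition K2 (k : nat) : rel 'I_(k.+2) :=
  fun i j => (i < 2)%N != (j < 2)%N.

(* SK_{2,k} on 'I_(k.+3): K_{2,k} on vertices 0..k+1 with the edge {0,2}
   subdivided by the new vertex z = k+2 *)
Definition SK2 (k : nat) : rel 'I_(k.+3) :=
  fun i j =>
    let z := k.+2 in
    let old a b := [&& (a < z)%N, (b < z)%N, (a < 2)%N != (b < 2)%N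
                    & ~~ (((a == 0) && (b == 2)) || ((a == 2) && (b == 0)))]%N in
    old (i : nat) (j : nat) ||
    ((i == z :> nat) && ((j == 0 :> nat) || (j == 2 :> nat))) ||
    ((j == z :> nat) && ((i == 0 :> nat) || (i == 2 :> nat))).

Arguments K2 k : clear implicits.
Arguments SK2 k : clear implicits.

Local Open Scope ring_scope.

Definition adjmx (R : realType) n (e : rel 'I_n) : 'M[R]_n :=
  \matrix_(i, j) (e i j)%:R.

(* spectral radius = largest eigenvalue of the adjacency matrix
   (the eigenvalue set is finite, and nonempty for n > 0) *)
Definition spec_rad (R : realType) n (e : rel 'I_n) : R :=
  sup [set l : R | eigenvalue (adjmx R e) l].

Definition rho1star (R : realType) (m : nat) : R :=
  sup [set x : R | x ^+ 3 - x ^+ 2 - (m%:R - 2) * x + m%:R - 3 = 0].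

(* Main.v *)
Require Import Defs.
From mathcomp Require Import all_boot all_order all_algebra.
From mathcomp Require Import boolp classical_sets reals.
From mathcomp Require Import ring lra zify.
(* Makes the finite-set lemma names shadow those of [classical_sets]. *)
Import mathcomp.boot.finset.
Import Order.TTheory GRing.Theory Num.Theory.
Local Open Scope ring_scope.

(** A cycle of a minimally 2-connected graph has no chord; in particular, the
    graph is triangle-free once it has at least four vertices.  Let [l] be an
    eigenvalue, normalize an eigenvector to have its entry of largest absolute
    value equal to 1, at [u] say, and put [B] for the neighbourhood of [u] and
    [W] for its complement.  Expanding [l^2 x_u] and using that [B] is
    independent gives [l^2 <= \sum_(b in B) deg b = m - e(W)], as well as
    [l <= deg u].

    If [l^2 >= m] then [W] is independent; chordlessness and the fact that [u]
    is not a cut vertex then force [K_{2,m/2}].  The cubic of part (ii) is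
    [(x - 1) (x^2 - (m - 2)) - 1], so its largest root [r] satisfies
    [r^2 > m - 2], and [l >= r] leaves at most one edge in [W].  No edge means
    [m] even; for one edge [w1 w2], the same arguments show that the graph is
    the edge [w1 w2] together with [p] (resp. [q]) paths of length two from [u]
    to [w1] (resp. [w2]).  With [a], [b] the entries at [w1], [w2], the
    eigenvalue equations add up to [(l - 1) (a + b) = l], whence
    [(l - 1) (l^2 - (m - 2)) = 1 - (l - 1) ((p - 1) (1 - a) + (q - 1) (1 - b))].
    The right-hand side is at most 1, so [l <= r], and equality forces [p = 1]
    or [q = 1], which is the graph [SK_{2,(m-1)/2}]. *)

(** * Chordless cycles *)

Lemma connect_exit {T : finType} {r : rel T} (P : pred T) x y :
  connect r x y -> P x -> ~~ P y -> exists z z', [/\ P z, ~~ P z' & r z z'].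
Proof.
case/connectP=> p; elim: p x => [|a p IH] x /=; first by move=> _ -> ->.
case/andP=> rxa pth yE Px Py; case: (boolP (P a)) => Pa.
  exact: IH pth yE Pa Py.
by exists x, a.
Qed.

Lemma exists_notin {n : nat} (A : {set 'I_n}) : (#|A| < n)%N -> exists z, z \notin A.
Proof.
move=> ltA; have [z] : exists z, z \in ~: A.
  by apply/card_gt0P; rewrite cardsCs setCK card_ord subn_gt0.
by rewrite inE; exists z.
Qed.

Lemma del_edge_sym {n : nat} {e : rel 'I_n} (x y : 'I_n) :
  symmetric e -> symmetric (del_edge e x y).
Proof.
move=> esym a b; rewrite /del_edge esym; congr (_ && ~~ _).
by rewrite orbC; congr (_ || _); rewrite andbC.
Qed.

(** The form in which 2-connectedness is used: a set that meets the vertices other than [v] and is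
    closed under the edges avoiding [v] contains them all. The sets [P] of the later proofs are
    built for this. *)
Lemma two_connected_exit {n : nat} {e : rel 'I_n} v {P : pred 'I_n} x y :
  two_connected e -> x != v -> y != v -> P x -> ~~ P y ->
  exists z z', [/\ P z, ~~ P z', z != v, z' != v & e z z'].
Proof.
case=> _ _ /(_ v) cv xv yv Px Py.
have /connect_exit /(_ Px Py) [z [z' [Pz Pz' /and3P[ezz' zv z'v]]]] :=
  cv x y (etrans (in_setC1 _ _) xv) (etrans (in_setC1 _ _) yv).
by exists z, z'; split=> //; [move: zv | move: z'v]; rewrite !inE.
Qed.

(** Minimum degree two: with [y] deleted, [v] is still joined to some third vertex. *)
Lemma two_connected_neighbour {n : nat} {e : rel 'I_n} v y :
  two_connected e -> v != y -> exists2 z, z != y & e v z.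
Proof.
move=> tc vy; have [n2 _ _] := tc.
have [z] : exists z, z \notin [set v; y].
  by apply: exists_notin; apply: leq_ltn_trans n2; rewrite cards2; case: (v != y).
rewrite !inE negb_or => /andP[zv zy].
have [a [b [/eqP-> _ _ bv evb]]] :=
  two_connected_exit y (P := pred1 v) v z tc vy zy (eqxx v) zv.
by exists b.
Qed.

Lemma path_del_edge {n : nat} {e : rel 'I_n} {x y : 'I_n} {p : seq 'I_n} :
  p != [::] -> x \notin p -> y \notin p -> path e x (rcons p y) ->
  path (del_edge e x y) x (rcons p y).
Proof.
case: p => // a p _; rewrite !inE !negb_or !(eq_sym _ a).
move=> /andP[ax xp] /andP[ay yp] /= /andP[exa epath].
rewrite /del_edge exa /= (negPf ax) (negPf ay) !andbF /=.
elim: p a ax ay xp yp epath {exa} => [|b p IH] a ax ay xp yp /=.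
  by rewrite /del_edge => /andP[-> _]; rewrite (negPf ax) (negPf ay).
move: xp yp; rewrite !inE !negb_or !(eq_sym _ b).
case/andP=> bx xp /andP[b_y yp] /andP[eab epath].
by rewrite /del_edge eab (negPf ax) (negPf ay) /= IH.
Qed.

(** [p] and [q] are the disjoint interiors of the two arcs of a cycle with chord [x y]. A vertex
    other than [x] and [y] lies on at most one arc, so the other arc replaces the chord, whose
    deletion then preserves 2-connectedness. *)
Lemma minimally_two_connected_chordless {n : nat} {e : rel 'I_n}
    (x y : 'I_n) (p q : seq 'I_n) :
  simple_graph e -> minimally_two_connected e -> e x y ->
  p != [::] -> q != [::] -> x \notin p ++ q -> y \notin p ++ q ->
  ~~ has (mem p) q ->
  path e x (rcons p y) -> ~ path e x (rcons q y).
Proof.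
move=> [esym eirr] [tc emin] exy p0 q0.
rewrite !mem_cat !negb_or => /andP[xp xq] /andP[yp yq] disj pathp pathq.
have [n2 ec ev] := tc; have dsym := del_edge_sym x y esym.
pose r (S : {set 'I_n}) a b := [&& del_edge e x y a b, a \in S & b \in S].
have sub_r S a b : r S a b -> del_edge e x y a b by case/and3P.
have rsym (S : {set 'I_n}) : connect_sym (r S).
  by apply: sym_connect_sym => a b; rewrite /r dsym; congr (_ && _); rewrite andbC.
have xy_r v : v != x -> v != y -> connect (r (~: [set v])) x y.
  move=> vx vy; have conn s : s != [::] -> x \notin s -> y \notin s -> v \notin s ->
      path e x (rcons s y) -> connect (r (~: [set v])) x y.
    move=> s0 xs ys vs paths; apply/connectP; exists (rcons s y); last by rewrite last_rcons.
    have sub : {in [pred a | a != v] &, subrel (del_edge e x y) (r (~: [set v]))}.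
      by move=> a b; rewrite /r !inE => -> -> ->.
    apply: (sub_in_path sub).
    - rewrite /= all_rcons /= ![_ == v]eq_sym vx vy /=.
      by apply/allP => a as_ /=; apply: contraNneq vs => <-.
    - exact: path_del_edge.
  case: (boolP (v \in p)) => vp; last exact: (conn p).
  apply: (conn q) => //; apply: contra disj => vq; apply/hasP; by exists v.
(* Every use of the edge [x y] is replaced by the connection that avoids it. *)
have reroute (S : {set 'I_n}) : connect (r S) x y -> connected_in e S ->
    connected_in (del_edge e x y) S.
  move=> cxy cS a b aS bS; have := cS a b aS bS; apply: connect_sub => {a b aS bS} a b.
  case/and3P=> eab aS bS; case: (boolP (del_edge e x y a b)) => [dab|].
    by apply: connect1; rewrite dab aS bS.
  rewrite /del_edge eab /= negbK => /orP[]/andP[/eqP-> /eqP->] //.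
  by rewrite -/(r S) rsym.
apply: (emin x y exy); split=> //.
- apply: reroute => //; have [z] : exists z, z \notin [set x; y].
    by apply: exists_notin; apply: leq_ltn_trans n2; rewrite cards2; case: (x != y).
  rewrite !inE negb_or => /andP[zx zy]; apply: connect_sub (xy_r z zx zy) => a b.
  by case/and3P=> dab _ _; apply: connect1; rewrite /r dab !inE.
(* Once [x] or [y] is deleted, the edge [x y] is gone anyway. *)
- move=> v; have incident a b : a != v -> b != v -> (v == x) || (v == y) -> e a b ->
      del_edge e x y a b.
    move=> av bv vxy eab; rewrite /del_edge eab /=.
    by case/orP: vxy => /eqP<-; rewrite (negPf av) (negPf bv) ?andbF.
  case: (boolP ((v == x) || (v == y))) => vxy; last first.
    by move: vxy; rewrite negb_or => /andP[vx vy]; apply: reroute => //; apply: xy_r.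
  move=> a b aS bS; have := ev v a b aS bS; apply: connect_sub => {a b aS bS} a b.
  case/and3P=> eab aS bS; apply: connect1; rewrite aS bS incident //.
  + by move: aS; rewrite !inE.
  + by move: bS; rewrite !inE.
Qed.

(* A path that leaves a triangle [x y z] at [x] and avoids [x] thereafter returns to
   the triangle at [y] or [z], and so turns an edge at [x] into a chord. *)
Lemma minimally_two_connected_triangle_free {n : nat} {e : rel 'I_n} (a b c : 'I_n) :
  simple_graph e -> minimally_two_connected e -> (3 < n)%N ->
  e a b -> e b c -> ~~ e a c.
Proof.
move=> sg mc n3; have [esym eirr] := sg; have [tc _] := mc.
have ne x y : e x y -> x != y by apply: contraTneq => ->; rewrite eirr.
(* In a triangle [x y z], the vertex [x] has no neighbour outside. [out] marks the vertices off the
   triangle and [r] is adjacency among them. *)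
have main x y z d : e x y -> e y z -> e x z -> d != y -> d != z -> ~~ e x d.
  move=> exy eyz exz dy dz; apply/negP => exd.
  pose out v := [&& v != x, v != y & v != z].
  pose r u v := [&& e u v, out u & out v].
  have outd : out d by rewrite /out dy dz eq_sym ne.
  have outc t : connect r d t -> out t.
    move=> cdt; apply: contraT => outt.
    have [v [w [_ outw /and3P[_ _ outw']]]] := connect_exit out _ _ cdt outd outt.
    by rewrite outw' in outw.
  have reach s t : connect r d s -> e s t -> (t == y) || (t == z) -> False.
    case/connectP=> p pathp -> elt tyz.
    have outp : all out (d :: p).
      elim: p d outd pathp {exd dy dz elt outc} => [|v p IH] d outd /=; first by rewrite outd.
      by case/andP=> /and3P[_ _ outv] /(IH _ outv) /= ->; rewrite outd.
    have notin v : ~~ out v -> v \notin d :: p by apply: contra => /(allP outp).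
    have epath : path e d p by apply: sub_path pathp => u v /and3P[].
    have [xN yN zN] : [/\ x \notin d :: p, y \notin d :: p & z \notin d :: p].
      by split; apply: notin; rewrite /out eqxx ?andbF.
    have pathq : path e x (rcons (d :: p) t) by rewrite /= exd rcons_path epath.
    (* The chord is [x w']; the arcs are [x w w'] and the detour through [d]. *)
    have fin w w' : w \notin d :: p -> w' \notin d :: p -> e x w -> e w w' ->
        e x w' -> path e x (rcons (d :: p) w') -> False.
      move=> wN w'N xw ww' xw'.
      apply: (minimally_two_connected_chordless x w' [:: w] (d :: p)) => //.
      - by rewrite mem_cat negb_or xN inE ne.
      - by rewrite mem_cat negb_or w'N inE eq_sym ne.
      - by apply/hasPn => v; rewrite !inE; apply: contraTneq => ->.
      - by rewrite /= xw ww'.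
    case/orP: tyz => /eqP tE; rewrite {}tE in pathq.
    - by apply: (fin z y) => //; rewrite esym.
    - exact: (fin y z).
  have yx : y != x by rewrite eq_sym ne.
  have dx : d != x by rewrite eq_sym ne.
  have cdy : ~~ connect r d y by apply/negP => /outc /and3P[]; rewrite eqxx.
  have [s [t [Ps Pt sx tx est]]] :=
    two_connected_exit x (P := connect r d) d y tc dx yx (connect0 _ _) cdy.
  have outs := outc s Ps.
  case: (boolP (out t)) => outt.
    by case/negP: Pt; apply: connect_trans Ps (connect1 _); apply/and3P.
  by apply: (reach s t) => //; move: outt; rewrite /out tx /= negb_and !negbK.
move=> eab ebc; apply/negP => eac.
(* A fourth vertex exists, so by connectivity some edge leaves the triangle, against [main] at its
   end in the triangle. *)
have [z zN] : exists z, z \notin [set a; b; c].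
  apply: exists_notin; apply: leq_ltn_trans n3.
  by rewrite setUC cardsU1 cards2; case: (a != b); case: (c \notin _).
have [_ cT _] := tc; have abcN : a \in [set a; b; c] by rewrite !inE eqxx.
have [s [t [Ps Pt /and3P[est _ _]]]] := connect_exit (mem [set a; b; c]) _ _
  (cT a z (in_setT _) (in_setT _)) abcN zN.
move: Ps Pt; rewrite !inE !negb_or => Ps /andP[/andP[ta tb] tc'].
have [eba eca ecb] : [/\ e b a, e c a & e c b] by split; rewrite esym.
case/orP: Ps => [/orP[]|] /eqP sE; apply/negP: est; rewrite sE.
- exact: (main a b c).
- exact: (main b a c).
- exact: (main c a b).
Qed.

(** * The complement of a neighbourhood *)

(** Otherwise the cycle [u b1 w b w' b2] would have the chord [u b]. *)
Lemma chordless_twins {n : nat} {e : rel 'I_n} (u w w' b b1 b2 : 'I_n) :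
  simple_graph e -> minimally_two_connected e ->
  w != u -> w' != u -> ~~ e u w -> ~~ e u w' -> w != w' ->
  e u b -> e u b1 -> e u b2 -> e w b -> e w b1 -> e w' b -> e w' b2 ->
  b1 != b -> b2 != b -> b1 = b2.
Proof.
move=> sg mc wu w'u uw uw' ww' ub ub1 ub2 wb wb1 w'b w'b2 b1b b2b.
have [esym eirr] := sg.
have ne x y z : e x y -> ~~ e x z -> y != z by move=> xy; apply: contraNneq => <-.
have nu x : e u x -> x != u by apply: contraTneq => ->; rewrite eirr.
apply/eqP; apply: contraT => b12; exfalso.
apply: (minimally_two_connected_chordless u b [:: b1; w] [:: b2; w'] sg mc) => //.
- rewrite /= !inE !negb_or; do ?[apply/andP; split];
    by [|rewrite eq_sym|exact: nu|rewrite eq_sym nu|exact: (ne u)|rewrite eq_sym (ne u)].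
- rewrite /= !inE !negb_or; do ?[apply/andP; split];
    by [|rewrite eq_sym|exact: nu|rewrite eq_sym nu|exact: (ne u)|rewrite eq_sym (ne u)].
- rewrite /= !inE orbF !negb_or; do ?[apply/andP; split];
    by [|rewrite eq_sym|exact: nu|rewrite eq_sym nu|exact: (ne u)|rewrite eq_sym (ne u)].
- by rewrite /= ub1 esym wb1 wb.
- by rewrite /= ub2 esym w'b2 w'b.
Qed.

(** Otherwise the cycle [u b' w b w1 w2 b2] would have the chord [u b]. *)
Lemma chordless_edge_twins {n : nat} {e : rel 'I_n} (u w w1 w2 b b' b2 : 'I_n) :
  simple_graph e -> minimally_two_connected e ->
  w != u -> w1 != u -> w2 != u -> ~~ e u w -> ~~ e u w1 -> ~~ e u w2 ->
  w != w1 -> w != w2 -> e w1 w2 ->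
  e u b -> e u b' -> e u b2 -> e w b -> e w b' -> b' != b ->
  e w1 b -> ~~ e w2 b -> e w2 b2 -> b2 = b'.
Proof.
move=> sg mc wu w1u w2u uw uw1 uw2 ww1 ww2 w12 ub ub' ub2 wb wb' b'b w1b w2b w2b2.
have [esym eirr] := sg.
have ne x y z : e x y -> ~~ e x z -> y != z by move=> xy; apply: contraNneq => <-.
have nu x : e u x -> x != u by apply: contraTneq => ->; rewrite eirr.
apply/eqP; apply: contraT => b12; exfalso.
have b2b : b2 != b := ne w2 _ _ w2b2 w2b.
apply: (minimally_two_connected_chordless u b [:: b'; w] [:: b2; w2; w1] sg mc) => //.
- rewrite /= !inE !negb_or; do ?[apply/andP; split];
    by [|rewrite eq_sym|exact: nu|rewrite eq_sym nu|exact: (ne u)|rewrite eq_sym (ne u)].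
- rewrite /= !inE !negb_or; do ?[apply/andP; split];
    by [|rewrite eq_sym|exact: nu|rewrite eq_sym nu|exact: (ne u)|rewrite eq_sym (ne u)].
- rewrite /= !inE orbF !negb_or; do ?[apply/andP; split];
    by [|rewrite eq_sym|exact: nu|rewrite eq_sym nu|exact: (ne u)|rewrite eq_sym (ne u)].
- by rewrite /= ub' esym wb' wb.
- by rewrite /= ub2 esym w2b2 esym w12 w1b.
Qed.

(** The neighbours of a nonneighbour [w] of [u], together with the nonneighbours of [u] sharing one
    with [w], are closed in the graph without [u], hence are everything. Two nonneighbours then
    share some [b], and [chordless_twins] leaves [u] at most one neighbour besides [b]. *)
Lemma independent_nonneighbours_complete {n : nat} {e : rel 'I_n} (u : 'I_n) :
  simple_graph e -> minimally_two_connected e -> (3 < n)%N ->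
  (forall i j, ~~ e u i -> ~~ e u j -> ~~ e i j) ->
  (forall w b, w != u -> ~~ e u w -> e u b -> e w b) /\
  ((2 < #|[set b | e u b]|)%N ->
   forall w w', w != u -> ~~ e u w -> w' != u -> ~~ e u w' -> w = w').
Proof.
move=> sg mc n3 indep; have [esym eirr] := sg; have [tc _] := mc.
have tf x y z := minimally_two_connected_triangle_free x y z sg mc n3.
have nbr w b : ~~ e u w -> e w b -> e u b.
  by move=> uw wb; apply: contraLR wb => ub; apply: indep.
have all_reach w z : w != u -> ~~ e u w -> z != u ->
    (e w z || ~~ e u z && [exists b, e w b && e z b]).
  move=> wu uw zu; apply: contraT => zP.
  pose P z := (e w z || ~~ e u z && [exists b, e w b && e z b]).
  have [b0 _ wb0] := two_connected_neighbour w u tc wu.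
  have b0u : b0 != u by apply: contraTneq wb0 => ->; rewrite esym.
  have Pb0 : P b0 by rewrite /P wb0.
  have [s [t [Ps Pt su tu st]]] := two_connected_exit u b0 z tc b0u zu Pb0 zP.
  case/negP: Pt; rewrite /P; case/orP: Ps => [ws | /andP[us /existsP[b /andP[wb sb]]]].
    apply/orP; right; rewrite (tf u s t (nbr w s uw ws) st) /=.
    by apply/existsP; exists s; rewrite ws esym.
  have [-> | tb] := eqVneq t b; first by rewrite wb.
  have [<- | sw] := eqVneq s w; first by rewrite st.
  (* Both [w] and [s] see [b], so the second neighbour [b1] of [w] must be [t]. *)
  have [b1 b1b wb1] : exists2 b1, b1 != b & e w b1.
    by apply: two_connected_neighbour => //; apply: contraTneq wb => ->; rewrite eirr.
  have [ub ub1 ut] : [/\ e u b, e u b1 & e u t].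
    by split; [apply: nbr wb|apply: nbr wb1|apply: nbr st].
  by rewrite -(chordless_twins u w s b b1 t sg mc) ?wb1 // eq_sym.
split=> [w b wu uw ub | d3 w w' wu uw w'u uw'].
  have bu : b != u by apply: contraTneq ub => ->; rewrite eirr.
  by have := all_reach w b wu uw bu; rewrite ub orbF.
apply/eqP; apply: contraTT d3 => ww'; rewrite -leqNgt.
have := all_reach w w' wu uw w'u; rewrite (negPf (indep _ _ uw uw')) uw' /=.
case/existsP=> b /andP[wb w'b]; have ub := nbr _ _ uw wb.
have [b2 b2b w'b2] : exists2 b2, b2 != b & e w' b2.
  by apply: two_connected_neighbour => //; apply: contraTneq w'b => ->; rewrite eirr.
have ub2 := nbr _ _ uw' w'b2.
apply: leq_trans (_ : #|[set b; b2]| <= 2)%N; last by rewrite cards2; case: (b != b2).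
apply/subset_leq_card/fintype.subsetP => c; rewrite !inE => uc; have [//|cb /=] := eqVneq c b.
have cu : c != u by apply: contraTneq uc => ->; rewrite eirr.
apply/eqP; apply: (chordless_twins u w w' b c b2 sg mc) => //.
by have := all_reach w c wu uw cu; rewrite uc orbF => wc.
Qed.

(** The set [P] of the proof grows from [w1], [w2] by their neighbours next to [u], then by the
    nonneighbours of [u] attached to these. It is closed in the graph without [u], so every
    neighbour of [u] is joined to [w1] or [w2], and by triangle-freeness not to both. A third
    nonneighbour would leave [u] with degree at most two. *)
Lemma single_edge_nonneighbours {n : nat} {e : rel 'I_n} (u w1 w2 : 'I_n) :
  simple_graph e -> minimally_two_connected e -> (3 < n)%N ->
  (2 < #|[set b | e u b]|)%N ->
  ~~ e u w1 -> ~~ e u w2 -> e w1 w2 ->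
  (forall i j, ~~ e u i -> ~~ e u j -> e i j ->
    (i == w1) && (j == w2) || (i == w2) && (j == w1)) ->
  [/\ forall w, w != u -> ~~ e u w -> (w == w1) || (w == w2),
      forall b, e u b -> e w1 b = ~~ e w2 b,
      (exists2 b, e u b & e w1 b) & (exists2 b, e u b & e w2 b)].
Proof.
move=> sg mc n3 d3 uw1 uw2 w12 single; have [esym eirr] := sg; have [tc _] := mc.
have tf x y z := minimally_two_connected_triangle_free x y z sg mc n3.
have w21 : e w2 w1 by rewrite esym.
have w1u : w1 != u by apply: contraTneq w12 => ->.
have w2u : w2 != u by apply: contraTneq w21 => ->.
have w1w2 : w1 != w2 by apply: contraTneq w12 => ->; rewrite eirr.
have w2w1 : w2 != w1 by rewrite eq_sym.
have excl b : e w1 b -> ~~ e w2 b.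
  by move=> w1b; apply: contraTN w12 => w2b; apply: (tf _ b) => //; rewrite esym.
have excl' b : e w2 b -> ~~ e w1 b by apply: contraTN; apply: excl.
have nbr1 b : e w1 b -> b != w2 -> e u b.
  move=> w1b bw2; apply: contraT => ub.
  by have := single _ _ uw1 ub w1b; rewrite (negPf bw2) (negPf w1w2) andbF.
have nbr2 b : e w2 b -> b != w1 -> e u b.
  move=> w2b bw1; apply: contraT => ub.
  by have := single _ _ uw2 ub w2b; rewrite (negPf bw1) (negPf w2w1) andbF.
have nbr w b : w != w1 -> w != w2 -> ~~ e u w -> e w b -> e u b.
  move=> ww1 ww2 uw wb; apply: contraT => ub.
  by have := single _ _ uw ub wb; rewrite (negPf ww1) (negPf ww2).
have [b1 b1w2 w1b1] := two_connected_neighbour w1 w2 tc w1w2.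
have [b2 b2w1 w2b2] := two_connected_neighbour w2 w1 tc w2w1.
have [ub1 ub2] : e u b1 /\ e u b2 by split; [apply: nbr1 | apply: nbr2].
(* For a third nonneighbour [w] with neighbours [b] and [b']: if [b] is joined to one end of
   [w1 w2], then only [b'] can join [u] to the other end. *)
have key w b b' c : w != u -> ~~ e u w -> w != w1 -> w != w2 -> e w b -> e w b' ->
    b' != b -> e u c -> (e w1 b -> e w2 c -> c = b') /\ (e w2 b -> e w1 c -> c = b').
  move=> wu uw ww1 ww2 wb wb' b'b uc.
  have [ub ub'] : e u b /\ e u b' by split; apply: (nbr w).
  split=> [w1b w2c | w2b w1c].
    exact: (chordless_edge_twins u w w1 w2 b b' c sg mc
      _ _ _ _ _ _ _ _ _ _ _ _ _ _ _ _ (excl _ w1b)).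
  exact: (chordless_edge_twins u w w2 w1 b b' c sg mc
      _ _ _ _ _ _ _ _ _ _ _ _ _ _ _ _ (excl' _ w2b)).
pose N b := e u b && (e w1 b || e w2 b).
pose P z := [|| z == w1, z == w2, N z | ~~ e u z && [exists b, N b && e z b]].
have reach z : z != u -> P z.
  move=> zu; apply: contraT => zP; have Pw1 : P w1 by rewrite /P eqxx.
  have [s [t [Ps Pt su tu st]]] := two_connected_exit u w1 z tc w1u zu Pw1 zP.
  move: Pt; rewrite /P !negb_or => /and4P[tw1 tw2 Nt /negP[]].
  have Nt_false : N t -> False by move=> Nt'; rewrite Nt' in Nt.
  have [sw1 | sw1] := eqVneq s w1.
    by case: Nt_false; rewrite /N -sw1 st (nbr1 t) // -sw1.
  have [sw2 | sw2] := eqVneq s w2.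
    by case: Nt_false; rewrite /N -sw2 st (nbr2 t) ?orbT // -sw2.
  move: Ps; rewrite /P (negPf sw1) (negPf sw2) /= => /orP[Ns | /andP[us]].
    rewrite (tf u s t (proj1 (andP Ns)) st) /=.
    by apply/existsP; exists s; rewrite Ns esym.
  case/existsP=> b /andP[/andP[ub Nb] sb]; case: Nt_false.
  have ut : e u t by apply: (nbr s).
  have [-> | tb] := eqVneq t b; first by rewrite /N ub.
  rewrite /N ut; case/orP: Nb => [w1b | w2b].
    have [<- //] := key s b t b2 su us sw1 sw2 sb st tb ub2.
    by rewrite w2b2 orbT.
  have [_ <- //] := key s b t b1 su us sw1 sw2 sb st tb ub1.
  by rewrite w1b1.
have ne x y z : e x y -> ~~ e x z -> y != z by move=> xy; apply: contraNneq => <-.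
have BN c : e u c -> e w1 c || e w2 c.
  move=> uc; have cu : c != u by apply: contraTneq uc => ->; rewrite eirr.
  have := reach c cu; rewrite /P uc orbF (negPf (ne _ _ _ uc uw1)).
  by rewrite (negPf (ne _ _ _ uc uw2)) => /andP[].
split; [| | by exists b1 | by exists b2].
- move=> w wu uw; apply: contraT; rewrite negb_or => /andP[ww1 ww2].
  have := reach w wu; rewrite /P (negPf ww1) (negPf ww2) /N (negPf uw) /=.
  case/existsP=> b /andP[/andP[ub Nb] wb].
  have [b' b'b wb'] : exists2 b', b' != b & e w b'.
    by apply: two_connected_neighbour => //; apply: contraTneq wb => ->; rewrite eirr.
  have bb' : b != b' by rewrite eq_sym.
  have ub' := nbr w b' ww1 ww2 uw wb'.
  move: d3; rewrite ltnNge => /negP[].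
  apply: leq_trans (_ : #|[set b; b']| <= 2)%N; last by rewrite cards2; case: (b != b').
  apply/subset_leq_card/fintype.subsetP => c; rewrite !inE => uc; apply/orP.
  (* [b] and [b'] turn out to be joined to different ends of [w1 w2]; [key], applied from both,
     identifies every neighbour [c] of [u] with one of them. *)
  have k := key w b b' _ wu uw ww1 ww2 wb wb' b'b; have k' := key w b' b _ wu uw ww1 ww2 wb' wb bb'.
  case/orP: Nb => [w1b | w2b].
    have [/(_ w1b w2b2) b2E _] := k b2 ub2; rewrite -b2E in k' *.
    have [k1 _] := k c uc; have [_ k2] := k' c uc.
    by case/orP: (BN c uc) => [/(k2 w2b2)->|/(k1 w1b)->]; rewrite ?b2E eqxx; [left|right].
  have [_ /(_ w2b w1b1) b1E] := k b1 ub1; rewrite -b1E in k' *.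
  have [_ k1] := k c uc; have [k2 _] := k' c uc.
  by case/orP: (BN c uc) => [/(k1 w2b)->|/(k2 w1b1)->]; rewrite ?b1E eqxx; [right|left].
- move=> b ub; case: (boolP (e w2 b)) => [/excl'/negPf-> // | w2b].
  by have := BN b ub; rewrite (negPf w2b) orbF.
Qed.

(** * Eigenvectors and degree counts *)

Lemma sum_adjacency {n : nat} {e : rel 'I_n} :
  simple_graph e -> (\sum_i \sum_j e i j = (gsize e).*2)%N.
Proof.
case=> esym eirr.
have -> : gsize e = (\sum_(i : 'I_n) \sum_(j : 'I_n) ((i < j) && e i j))%N.
  rewrite /gsize -sum1_card pair_bigA big_mkcond /=; apply: eq_bigr => p _.
  by rewrite inE; case: ifP.
rewrite -addnn [in X in (_ + X)%N]exchange_big -big_split; apply: eq_bigr => i _.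
rewrite -big_split; apply: eq_bigr => j _ /=.
rewrite [e j i]esym; case: ltngtP => //= ij; first by rewrite addn0.
by rewrite (ord_inj ij) eirr.
Qed.

(** The neighbourhood of [u] is independent, so its degree sum counts exactly once each edge that
    meets it. Everything is doubled because the remaining edges are counted as ordered pairs. *)
Lemma neighbour_degree_sum {n : nat} {e : rel 'I_n} (u : 'I_n) :
  simple_graph e -> (forall x y z, e x y -> e y z -> ~~ e x z) ->
  ((\sum_(b | e u b) \sum_j e b j).*2 +
     \sum_(i | ~~ e u i) \sum_(j | ~~ e u j) e i j = (gsize e).*2)%N.
Proof.
move=> sg tf; have [esym _] := sg; rewrite -(sum_adjacency sg).
have -> : (\sum_(i | ~~ e u i) \sum_(j | ~~ e u j) e i j =
    \sum_i \sum_j [&& ~~ e u i, ~~ e u j & e i j])%N.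
  rewrite big_mkcond; apply: eq_bigr => i _; case: ifP => ui; last by rewrite big1.
  by rewrite big_mkcond; apply: eq_bigr => j _; case: ifP.
have eS : (\sum_(b | e u b) \sum_j e b j = \sum_i \sum_j (e u i && e i j))%N.
  by rewrite big_mkcond; apply: eq_bigr => i _; case: ifP => //; rewrite big1.
rewrite -addnn eS [in X in (X + _ + _)%N]exchange_big -!big_split; apply: eq_bigr => i _.
rewrite -!big_split; apply: eq_bigr => j _ /=; rewrite [e j i]esym.
case: (boolP (e u i)) => [ui|_]; last by case: (e u j); case: (e i j).
case: (boolP (e u j)) => [uj|_]; last by case: (e i j).
by rewrite (negPf (tf i u j _ uj)) // esym.
Qed.

(** The zero function qualifies; nonvanishing is stated separately. *)
Definition eigenvector {R : realType} {n : nat} (e : rel 'I_n) (l : R) (x : 'I_n -> R) :=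
  forall i, \sum_(j | e i j) x j = l * x i.

Lemma eigenvalue_adjmxP {R : realType} {n : nat} {e : rel 'I_n} {l : R} :
  symmetric e ->
  eigenvalue (adjmx R e) l <-> exists x, eigenvector e l x /\ exists i, x i != 0.
Proof.
move=> esym; have mulE (v : 'rV[R]_n) i : (v *m adjmx R e) 0 i = \sum_(j | e i j) v 0 j.
  rewrite mxE [RHS]big_mkcond; apply: eq_bigr => j _.
  by rewrite mxE esym; case: (e i j); rewrite ?mulr1 ?mulr0.
split=> [/eigenvalueP[v vE v0] | [x [xE [i xi]]]].
  exists (v 0); split=> [i|]; first by rewrite -mulE vE mxE.
  by apply/rV0Pn.
apply/eigenvalueP; exists (\row_j x j).
  apply/rowP => j; rewrite mulE !mxE -xE; apply: eq_bigr => k _; by rewrite mxE.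
by apply/rV0Pn; exists i; rewrite mxE.
Qed.

(** Division by the entry of largest absolute value, sign included, makes that entry 1 itself; for
    the others only the upper bound is kept. *)
Lemma eigenvector_normalized {R : realType} {n : nat} {e : rel 'I_n} {l : R} :
  symmetric e -> eigenvalue (adjmx R e) l ->
  exists x u, [/\ eigenvector e l x, x u = 1 & forall j, x j <= 1].
Proof.
move=> esym /(eigenvalue_adjmxP esym)[x [xE [i xi]]].
pose u := [arg max_(j > i) `|x j|]%O.
have xu : forall j, `|x j| <= `|x u| by rewrite /u; case: arg_maxP => // j _ H k; apply: H.
have xu0 : x u != 0 by rewrite -normr_gt0 (lt_le_trans _ (xu i)) // normr_gt0.
exists (fun j => x j / x u), u; split=> [j||j]; last 1 first.
- by rewrite (le_trans (ler_norm _)) // normrM normfV ler_pdivrMr ?normr_gt0 // mul1r.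
- by rewrite -mulr_suml xE mulrA.
- by rewrite divff.
Qed.

Lemma eigenvalue_le_degree {R : realType} {n : nat} {e : rel 'I_n} {l : R} {x} {u : 'I_n} :
  eigenvector e l x -> x u = 1 -> (forall j, x j <= 1) -> l <= #|[set b | e u b]|%:R.
Proof.
move=> xE xu x1; have := xE u; rewrite xu mulr1 => <-.
rewrite cardsE -sum1_card natr_sum; exact: ler_sum.
Qed.

(** [l ^+ 2] is the sum of [x] over the ends of the walks of length two from [u], and the right-hand
    side counts these walks. *)
Lemma eigenvalue_sqr_le {R : realType} {n : nat} {e : rel 'I_n} {l : R} {x} {u : 'I_n} :
  eigenvector e l x -> x u = 1 -> (forall j, x j <= 1) ->
  l ^+ 2 <= (\sum_(b | e u b) \sum_j e b j)%N%:R.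
Proof.
move=> xE xu x1; have := xE u; rewrite xu mulr1 expr2 => {1}<-.
rewrite mulr_suml natr_sum; apply: ler_sum => b _.
rewrite mulrC -xE natr_sum big_mkcond; apply: ler_sum => j _.
by case: (e b j).
Qed.

(* [1], [a], [b] are the entries of an eigenvector at the hubs [u], [w1], [w2] of
   the graph made of the edge [w1 w2] and of [p] (resp. [q]) paths of length two
   from [u] to [w1] (resp. [w2]); it has [2 * (p + q) + 1] edges. *)
Lemma reduced_eigen_system {R : realType} {l a b : R} {p q : nat} :
  0 < l -> (0 < p)%N -> (0 < q)%N -> (2 < p + q)%N -> a <= 1 -> b <= 1 ->
  l ^+ 2 = p%:R * (1 + a) + q%:R * (1 + b) ->
  l ^+ 2 * a = l * b + p%:R * (1 + a) ->
  l ^+ 2 * b = l * a + q%:R * (1 + b) ->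
  2 * (p + q)%:R - 1 < l ^+ 2 ->
  (l - 1) * (l ^+ 2 - (2 * (p + q)%:R - 1)) <= 1 /\
  ((l - 1) * (l ^+ 2 - (2 * (p + q)%:R - 1)) = 1 -> p = 1%N \/ q = 1%N).
Proof.
move=> l0 p0 q0 pq3 a1 b1 E0 E1 E2 lt_l.
have pqR : 3 <= (p + q)%:R :> R by rewrite ler_nat.
(* Here [l ^+ 2 > 2 * 3 - 1 = 5]. *)
have l2 : 2 < l by nra.
(* Adding [E1] and [E2] produces the right-hand side of [E0]; then one factor [l] cancels. *)
have sab : (l - 1) * (a + b) = l.
  apply: (mulfI (lt0r_neq0 l0)); lra.
have P : 1 <= p%:R :> R by rewrite ler1n.
have Q : 1 <= q%:R :> R by rewrite ler1n.
have defect : l ^+ 2 - (2 * (p + q)%:R - 1) =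
    (a + b - 1) - (p%:R - 1) * (1 - a) - (q%:R - 1) * (1 - b).
  rewrite E0 natrD; ring.
have pa : 0 <= (p%:R - 1) * (1 - a) by rewrite mulr_ge0 ?subr_ge0.
have qb : 0 <= (q%:R - 1) * (1 - b) by rewrite mulr_ge0 ?subr_ge0.
have D : (l - 1) * (l ^+ 2 - (2 * (p + q)%:R - 1)) =
   1 - (l - 1) * ((p%:R - 1) * (1 - a) + (q%:R - 1) * (1 - b)).
  rewrite defect; transitivity ((l - 1) * (a + b) - (l - 1) -
    (l - 1) * ((p%:R - 1) * (1 - a) + (q%:R - 1) * (1 - b))); first by ring.
  by rewrite sab; ring.
have S : 0 <= (p%:R - 1) * (1 - a) + (q%:R - 1) * (1 - b) by rewrite addr_ge0.
split; first by rewrite D gerBl mulr_ge0 //; lra.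
rewrite D => Z.
have {}S : (p%:R - 1) * (1 - a) + (q%:R - 1) * (1 - b) = 0.
  by apply: (mulfI (_ : l - 1 != 0)); [apply: lt0r_neq0|]; lra.
have [->|p1] := eqVneq p 1%N; first by left.
have [->|q1] := eqVneq q 1%N; first by right.
have p2 : 2 <= p%:R :> R by rewrite ler_nat ltn_neqAle eq_sym p1.
have q2 : 2 <= q%:R :> R by rewrite ler_nat ltn_neqAle eq_sym q1.
(* With [p] and [q] at least 2, the vanishing sum forces [a = b = 1], and [sab] then gives
   [l = 2]. *)
exfalso; nra.
Qed.

(** * The extremal graphs *)

(** Isomorphisms are built as numberings with values in [nat]; bijectivity follows from injectivity
    by cardinality. *)
Lemma graph_iso_inj {n n' : nat} {e : rel 'I_n} {e' : rel 'I_n'} (g : 'I_n -> nat) :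
  (n' <= n)%N -> injective g -> forall ltg : (forall i, (g i < n')%N),
  (forall i j, e' (Ordinal (ltg i)) (Ordinal (ltg j)) = e i j) -> graph_iso e e'.
Proof.
move=> le_n' ginj ltg eE; exists (fun i => Ordinal (ltg i)); split=> //.
by apply: inj_card_bij; [move=> i j [/ginj] | rewrite !card_ord].
Qed.

Lemma index_set_lt {T : finType} (A : {set T}) i :
  i \in A -> (index i (enum A) < #|A|)%N.
Proof. by move=> iA; rewrite cardE index_mem mem_enum. Qed.

Lemma index_set_inj {T : finType} (A : {set T}) i j :
  i \in A -> index i (enum A) = index j (enum A) -> i = j.
Proof.
move=> iA ij; rewrite -(nth_index i (_ : i \in enum A)) ?mem_enum // ij nth_index //.
by rewrite -index_mem -ij index_mem mem_enum.
Qed.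

Lemma graph_iso_K2 {n : nat} {e : rel 'I_n} (u w : 'I_n) :
  simple_graph e -> (forall x y z, e x y -> e y z -> ~~ e x z) ->
  w != u -> ~~ e u w -> (forall z, z != u -> ~~ e u z -> z = w) ->
  (forall b, e u b -> e w b) -> graph_iso e (K2 #|[set b | e u b]|).
Proof.
move=> [esym eirr] tf wu uw onlyw wB; set B := [set b | e u b].
pose g i := if i == u then 0%N else if i == w then 1%N else (index i (enum B)).+2.
have BP i : i != u -> i != w -> i \in B.
  by move=> iu iw; rewrite inE; apply: contraNT iw => /(onlyw _ iu) ->.
have lt_g i : (g i < #|B|.+2)%N.
  rewrite /g; case: eqVneq => // iu; case: eqVneq => // iw.
  by rewrite !ltnS index_set_lt ?BP.
apply: (@graph_iso_inj _ _ _ _ g _ _ lt_g).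
- have uB : u \notin w |: B by rewrite !inE eirr eq_sym negb_or wu.
  have wBN : w \notin B by rewrite inE.
  have := max_card (mem (u |: (w |: B))).
  by rewrite card_ord !cardsU1 uB wBN.
- move=> i j; rewrite /g; case: (eqVneq i u) => [->|iu]; case: (eqVneq j u) => [->|ju] //.
  + by case: ifP.
  + by case: ifP.
  case: (eqVneq i w) => [->|iw]; case: (eqVneq j w) => [->|jw] //.
  by case=> /index_set_inj -> //; apply: BP.
- move=> i j; rewrite /K2 /= /g.
  have eN k k' : k \in B -> k' \in B -> e k k' = false.
    by rewrite !inE => uk uk'; apply/negbTE/(tf k u); rewrite // esym.
  case: (eqVneq i u) => [->|iu].
    case: (eqVneq j u) => [->|ju]; first by rewrite eirr.
    case: (eqVneq j w) => [->|jw]; first by rewrite (negPf uw).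
    by have := BP j ju jw; rewrite inE => ->.
  case: (eqVneq i w) => [->|iw].
    case: (eqVneq j u) => [->|ju]; first by rewrite esym (negPf uw).
    case: (eqVneq j w) => [->|jw]; first by rewrite eirr.
    by have := BP j ju jw; rewrite inE => /wB ->.
  have iB := BP i iu iw.
  case: (eqVneq j u) => [->|ju]; first by move: iB; rewrite inE esym => ->.
  case: (eqVneq j w) => [->|jw]; first by move: iB; rewrite inE => /wB; rewrite esym => ->.
  by rewrite eN // BP.
Qed.

Ltac lia_on_indices :=
  try move: (index _ _); try move: (index _ _); move: (#|_|); clear; lia.

(** As [b2] is the only vertex joining [u] to [w2], the path [u b2 w2] is an edge of a complete
    bipartite graph with hubs [u], [w1], subdivided by [b2]. So [w2] receives the number 2 and [b2]
    the last one. *)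
Lemma graph_iso_SK2 {n : nat} {e : rel 'I_n} (u w1 w2 b2 : 'I_n) :
  simple_graph e -> (forall x y z, e x y -> e y z -> ~~ e x z) ->
  w1 != u -> w2 != u -> ~~ e u w1 -> ~~ e u w2 -> e w1 w2 ->
  (forall w, w != u -> ~~ e u w -> (w == w1) || (w == w2)) ->
  (forall b, e u b -> e w1 b = ~~ e w2 b) ->
  e u b2 -> (forall b, e u b -> e w2 b = (b == b2)) ->
  graph_iso e (SK2 #|[set b | e u b]|).
Proof.
move=> [esym eirr] tf w1u w2u uw1 uw2 w12 onlyw excl ub2 w2B.
have w1w2 : w1 != w2 by apply: contraTneq w12 => ->; rewrite eirr.
have b2u : b2 != u by apply: contraTneq ub2 => ->; rewrite eirr.
have b2w1 : b2 != w1 by apply: contraTneq ub2 => ->.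
have b2w2 : b2 != w2 by apply: contraTneq ub2 => ->.
set B := [set b | e u b]; pose N1 := B :\ b2.
have BE : #|B| = #|N1|.+1 by rewrite (cardsD1 b2) inE ub2.
pose g i := if i == u then 0%N else if i == w1 then 1%N else if i == w2 then 2%N
  else if i == b2 then #|B|.+2 else (index i (enum N1)).+3.
have NP i : i != u -> i != w1 -> i != w2 -> i != b2 -> i \in N1.
  move=> iu iw1 iw2 ib2; rewrite !inE ib2; apply: contraT => /(onlyw _ iu).
  by rewrite (negPf iw1) (negPf iw2).
have index_ltN i : i \in N1 -> (index i (enum N1) < #|N1|)%N := @index_set_lt _ N1 i.
have lt_g i : (g i < #|B|.+3)%N.
  rewrite /g; case: eqVneq => // iu; case: eqVneq => // iw1; case: eqVneq => // iw2.
  case: eqVneq => // ib2; rewrite BE !ltnS ltnW // index_ltN //; exact: NP.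
apply: (@graph_iso_inj _ _ _ _ g _ _ lt_g).
- have u_out : u \notin w1 |: (w2 |: B).
    by rewrite !inE eirr ![u == _]eq_sym !negb_or w1u w2u.
  have w1_out : w1 \notin w2 |: B by rewrite !inE negb_or w1w2.
  have w2_out : w2 \notin B by rewrite inE.
  have := max_card (mem (u |: (w1 |: (w2 |: B)))).
  by rewrite card_ord !cardsU1 u_out w1_out w2_out.
- move=> i j; rewrite /g.
  case: (eqVneq i u) => [->|iu].
    by case: (eqVneq j u) => [->//|_]; do 3!case: ifP => // _.
  case: (eqVneq i w1) => [->|iw1].
    case: (eqVneq j u) => // ju; case: (eqVneq j w1) => [->//|jw1].
    by do 2!case: ifP => // _.
  case: (eqVneq i w2) => [->|iw2].
    case: (eqVneq j u) => // ju; case: (eqVneq j w1) => // jw1.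
    case: (eqVneq j w2) => [->//|jw2].
    by case: ifP => // _; rewrite BE.
  case: (eqVneq i b2) => [->|ib2].
    case: (eqVneq j u) => // ju; case: (eqVneq j w1) => // jw1.
    case: (eqVneq j w2) => [_|jw2]; first by rewrite BE.
    case: (eqVneq j b2) => [->//|jb2].
    by have := index_ltN j (NP j ju jw1 jw2 jb2); rewrite BE => + [E]; rewrite E ltnn.
  have iN := NP i iu iw1 iw2 ib2.
  case: (eqVneq j u) => // ju; case: (eqVneq j w1) => // jw1.
  case: (eqVneq j w2) => // jw2.
  case: (eqVneq j b2) => [->|jb2].
    by have := index_ltN i iN; rewrite BE => + [E]; rewrite E ltnn.
  by case=> /index_set_inj; apply.
have adjN i : i \in N1 -> [/\ e u i, e w1 i, e w2 i = false & e b2 i = false].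
  rewrite !inE => /andP[ib2 ui]; split=> //; first by rewrite excl // w2B.
    by rewrite w2B // (negPf ib2).
  by apply/negbTE/(tf b2 u i); rewrite // esym.
have adjNN i j : i \in N1 -> j \in N1 -> e i j = false.
  move=> /adjN[ui _ _ _] /adjN[uj _ _ _].
  by apply/negbTE/(tf i u j); rewrite // esym.
have w2b2 : e w2 b2 by rewrite w2B.
have w1b2 : e w1 b2 = false by rewrite excl // w2b2.
move=> i j; rewrite /SK2 /= /g !BE.
case: (eqVneq i u) => [->|iu].
  case: (eqVneq j u) => [->|ju]; first by rewrite eirr.
  case: (eqVneq j w1) => [->|jw1]; first by rewrite (negPf uw1).
  case: (eqVneq j w2) => [->|jw2]; first by rewrite (negPf uw2).
  case: (eqVneq j b2) => [->|jb2]; first by rewrite ub2; lia_on_indices.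
  have jN := NP j ju jw1 jw2 jb2; have [-> _ _ _] := adjN j jN.
  by move: (index_ltN j jN); lia_on_indices.
case: (eqVneq i w1) => [->|iw1].
  case: (eqVneq j u) => [->|ju]; first by rewrite esym (negPf uw1).
  case: (eqVneq j w1) => [->|jw1]; first by rewrite eirr; lia_on_indices.
  case: (eqVneq j w2) => [->|jw2]; first by rewrite w12; lia_on_indices.
  case: (eqVneq j b2) => [->|jb2]; first by rewrite w1b2; lia_on_indices.
  have jN := NP j ju jw1 jw2 jb2; have [_ -> _ _] := adjN j jN.
  by move: (index_ltN j jN); lia_on_indices.
case: (eqVneq i w2) => [->|iw2].
  case: (eqVneq j u) => [->|ju]; first by rewrite esym (negPf uw2); lia_on_indices.
  case: (eqVneq j w1) => [->|jw1]; first by rewrite esym w12; lia_on_indices.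
  case: (eqVneq j w2) => [->|jw2]; first by rewrite eirr; lia_on_indices.
  case: (eqVneq j b2) => [->|jb2]; first by rewrite w2b2; lia_on_indices.
  have jN := NP j ju jw1 jw2 jb2; have [_ _ -> _] := adjN j jN.
  by move: (index_ltN j jN); lia_on_indices.
case: (eqVneq i b2) => [->|ib2].
  case: (eqVneq j u) => [->|ju]; first by rewrite esym ub2; lia_on_indices.
  case: (eqVneq j w1) => [->|jw1]; first by rewrite esym w1b2; lia_on_indices.
  case: (eqVneq j w2) => [->|jw2]; first by rewrite esym w2b2; lia_on_indices.
  case: (eqVneq j b2) => [->|jb2]; first by rewrite eirr; lia_on_indices.
  have jN := NP j ju jw1 jw2 jb2; have [_ _ _ ->] := adjN j jN.
  by move: (index_ltN j jN); lia_on_indices.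
have iN := NP i iu iw1 iw2 ib2; have [ui w1i w2i b2i] := adjN i iN.
have lti := index_ltN i iN.
case: (eqVneq j u) => [->|ju]; first by rewrite esym ui; move: lti; lia_on_indices.
case: (eqVneq j w1) => [->|jw1]; first by rewrite esym w1i; move: lti; lia_on_indices.
case: (eqVneq j w2) => [->|jw2]; first by rewrite esym w2i; move: lti; lia_on_indices.
case: (eqVneq j b2) => [->|jb2]; first by rewrite esym b2i; move: lti; lia_on_indices.
have jN := NP j ju jw1 jw2 jb2; rewrite adjNN //.
by move: lti (index_ltN j jN); lia_on_indices.
Qed.

(** * Eigenvectors of the extremal graphs *)

Lemma graph_iso_eigenvalue {R : realType} {n n' : nat} {e : rel 'I_n} {e' : rel 'I_n'}
    {l : R} {y : 'I_n' -> R} {i'} :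
  symmetric e -> graph_iso e e' -> eigenvector e' l y -> y i' != 0 ->
  eigenvalue (adjmx R e) l.
Proof.
move=> esym [f [[g fK gK] fE]] yE yi'; apply/(eigenvalue_adjmxP esym).
exists (y \o f); split=> [i|]; last by exists (g i'); rewrite /= gK.
rewrite /= -yE (reindex f) /=; last by exists g => j _.
by apply: eq_bigl => j; rewrite fE.
Qed.

Lemma eigenvector_K2 {R : realType} (k : nat) (l : R) :
  l ^+ 2 = (2 * k)%:R ->
  eigenvector (K2 k) l (fun i : 'I_k.+2 => if (i < 2)%N then l else 2).
Proof.
move=> lE i; rewrite big_mkcond !big_ord_recl /K2 /=.
case: (ltnP i 2) => i2 /=; rewrite /bump /=.
  by rewrite !add0r sumr_const card_ord -expr2 lE natrM mulr_natr.
by rewrite big1 // addr0 mulr_natr.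
Qed.

(** The graph has a symmetry exchanging the hubs 0 and 1 and the inner vertices [k.+3] and 2 of the
    path between them, hence only three values. The equation at a hub is the cubic; the others are
    identities. *)
Lemma eigenvector_SK2 {R : realType} (m k : nat) (l : R) :
  m = (2 * k + 3)%N -> l ^+ 3 - l ^+ 2 - (m%:R - 2) * l + m%:R - 3 = 0 ->
  eigenvector (SK2 k.+1) l (fun i : 'I_k.+4 =>
    if (i < 2)%N then l * (l - 1)
    else if (i == 2 :> nat) || (i == k.+3 :> nat) then l else 2 * (l - 1)).
Proof.
move=> -> lE [i lti]; rewrite big_mkcond big_ord_recr !big_ord_recl /SK2 /=.
rewrite (eq_bigr (fun=> if (i < 2)%N then 2 * (l - 1) else 0)) => [|j _]; last first.
  rewrite /bump /= !add1n !eqSS !ltnS ltn_ord (ltn_eqF (ltn_ord j)) /= !andbF !orbF.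
  by case: i {lti} => [|[|[|i]]] //=; rewrite ?eqSS ?ltnS ?andbF //.
have l_id : l * (l * (l - 1)) = l + 2 * (l - 1) *+ k.
  by move: lE; rewrite [(2 * k + 3)%:R]natrD [(2 * k)%:R]natrM -[_ *+ k]mulr_natr; lra.
case: i lti => [|[|[|i]]] lti; rewrite /bump /= ?ltnn ?eqxx ?andbF ?sumr_const ?card_ord /=;
  rewrite ?sumr_const ?card_ord ?mul0rn.
- by rewrite !add0r addrC l_id.
- by rewrite !add0r addr0 l_id.
- ring.
- move: lti; rewrite !ltnS !eqSS; case: ltngtP => //= _ _; ring.
Qed.

(** * Suprema of finite root sets as attained maxima *)

Lemma root_set_max {R : realType} {S : set R} {p : {poly R}} :
  p != 0 -> (forall x, S x -> root p x) -> (exists x, S x) ->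
  exists M, S M /\ forall x, S x -> x <= M.
Proof.
move=> p0 Sp [x0 Sx0].
(* Splitting off one root at a time lists all roots. *)
have [s sP] : exists s : seq R, forall x, root p x -> x \in s.
  move: {Sp} p0; have [k] := ubnP (size p); elim: k p => // k IH p ltk p0.
  have [[a pa] | nopa] := pselect (exists a, root p a); last first.
    by exists [::] => x px; case: nopa; exists x.
  have [q pE] := factor_theorem p a pa; have q0 : q != 0.
    by apply: contraNneq p0 => q0; rewrite pE q0 mul0r.
  have [|s sP] := IH q _ q0.
    by move: ltk; rewrite pE size_Mmonic ?monicXsubC // size_XsubC addn2.
  exists (a :: s) => x; rewrite pE rootM root_XsubC inE orbC.
  by case/orP=> [-> // | /sP ->]; rewrite orbT.
have : {in S, forall x, x \in s} by move=> x /set_mem /Sp /sP.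
elim: s {sP} S x0 Sx0 {Sp} => [|a s IH] S x0 Sx0 Ss.
  by have := Ss x0 (mem_set Sx0).
(* If some element of [S] exceeds the head [a], the maximum lies in the part above [a], which the
   tail of the list covers. *)
have [[b [Sb ab]] | nob] := pselect (exists b, S b /\ a < b); last first.
  have le_a x : S x -> x <= a.
    by move=> Sx; rewrite leNgt; apply/negP => ax; apply: nob; exists x.
  have [Sa | nSa] := pselect (S a); first by exists a.
  apply: (IH S x0 Sx0) => x xS; have := Ss x xS; rewrite inE => /orP[/eqP xa|//].
  by case: nSa; rewrite -xa; apply: set_mem.
have [|M [[SM aM] Mmax]] := IH (fun x => S x /\ a < x) b (conj Sb ab).
  move=> x /set_mem[Sx ax]; have := Ss x (mem_set Sx).
  by rewrite inE gt_eqF.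
exists M; split=> // x Sx; have [ax|xa] := ltP a x; first exact: Mmax.
exact: le_trans xa (ltW aM).
Qed.

Lemma sup_max {R : realType} {S : set R} {M : R} :
  S M -> (forall x, S x -> x <= M) -> sup S = M.
Proof.
move=> SM Mmax; apply/eqP; rewrite eq_le ge_sup //=; last by exists M.
by apply: ub_le_sup => //; exists M.
Qed.

(* Without a real eigenvalue, [spec_rad] would be [sup set0 = 0 < c], so that no
   spectral theorem is needed. *)
Lemma spec_rad_extremal {R : realType} {n : nat} {e : rel 'I_n} {c : R} {P : Prop} :
  0 < c -> (forall l, eigenvalue (adjmx R e) l -> c <= l -> l = c /\ P) ->
  (P -> eigenvalue (adjmx R e) c) ->
  spec_rad R e <= c /\ (spec_rad R e = c <-> P).
Proof.
move=> c0 extremal attained.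
have [[l el] | no_eig] := pselect (exists l, eigenvalue (adjmx R e) l).
  have [| M [eM Mmax]] := @root_set_max R [set l | eigenvalue (adjmx R e) l]
    (char_poly (adjmx R e)) (monic_neq0 (char_poly_monic _)) _ (ex_intro _ l el).
    by move=> x /=; rewrite eigenvalue_root_char.
  rewrite /spec_rad (sup_max eM Mmax); split.
    rewrite leNgt; apply/negP => cM.
    by have := cM; rewrite (extremal M eM (ltW cM)).1 ltxx.
  split=> [Mc | PP]; first by apply: (extremal M eM _).2; rewrite Mc.
  have cM := Mmax c (attained PP); exact: (extremal M eM cM).1.
have -> : spec_rad R e = 0.
  by apply: sup_out => -[[l el] _]; apply: no_eig; exists l.
split; first exact: ltW.
by split=> [c0E | /attained ec]; [rewrite -c0E ltxx in c0 | case: no_eig; exists c].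
Qed.

(** The cubic is nonnegative far out, so a root lies above every point where it is nonpositive.
    Bounding an eigenvalue by [rho1star] thus becomes a sign check. *)
Lemma rho1starP {R : realType} (m : nat) :
  let f (x : R) := x ^+ 3 - x ^+ 2 - (m%:R - 2) * x + m%:R - 3 in
  f (rho1star R m) = 0 /\ forall y, f y <= 0 -> y <= rho1star R m.
Proof.
move=> f; pose p : {poly R} := 'X^3 - 'X^2 - (m%:R - 2) *: 'X + (m%:R - 3)%:P.
have pE x : p.[x] = f x by rewrite !hornerE /f /=; ring.
have root_above y : f y <= 0 -> exists2 z, y <= z & f z = 0.
  move=> fy; have m0 : 0 <= m%:R :> R by [].
  pose M := `|y| + m%:R + 2; have yM : y <= M by rewrite /M; have := ler_norm y; lra.
  have M2 : m%:R + 2 <= M by rewrite /M; have := normr_ge0 y; lra.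
  have fM : 0 <= f M.
    have -> : f M = (M - 1) * (M ^+ 2 - m%:R + 2) - 1 by rewrite /f; ring.
    have : m%:R <= M ^+ 2 by nra.
    nra.
  have [|z /andP[yz _] /rootP] := poly_ivt (p := p) yM; first by rewrite !pE fy.
  by rewrite pE; exists z.
have p0 : p != 0.
  apply/eqP => p0; have : f 1 = -1 by rewrite /f; ring.
  by rewrite -pE p0 horner0 => /eqP; rewrite eq_sym oppr_eq0 oner_eq0.
(* [f 1 = -1] provides a root. *)
have [z _ fz] : exists2 z, 1 <= z & f z = 0 by apply: root_above; rewrite /f; lra.
have [|M [fM Mmax]] := @root_set_max R [set x | f x = 0] p p0 _ (ex_intro _ z fz).
  by move=> x fx; apply/rootP; rewrite pE.
rewrite /rho1star -/f (sup_max fM Mmax); split=> // y /root_above[x yx fx].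
exact: le_trans yx (Mmax x fx).
Qed.

(** * The extremal eigenvalues *)

Lemma adjacency_sum_set {n : nat} {e : rel 'I_n} (P : pred 'I_n) :
  (\sum_(i | P i) \sum_(j | P j) e i j = #|[set p | [&& P p.1, P p.2 & e p.1 p.2]]|)%N.
Proof.
rewrite -sum1_card big_mkcond [RHS]big_mkcond /=.
rewrite (eq_bigr (fun i => \sum_j [&& P i, P j & e i j]))%N => [|i _]; last first.
  case: ifP => Pi; last by rewrite big1.
  by rewrite big_mkcond; apply: eq_bigr => j _; case: ifP.
by rewrite pair_bigA; apply: eq_bigr => p _; rewrite inE; case: ifP.
Qed.

(** Each edge contributes two ordered pairs, so a second edge would bring the sum to four. *)
Lemma adjacency_sum_unique_edge {n : nat} {e : rel 'I_n} {P : pred 'I_n} {a b} :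
  simple_graph e -> P a -> P b -> e a b ->
  (\sum_(i | P i) \sum_(j | P j) e i j < 4)%N ->
  (\sum_(i | P i) \sum_(j | P j) e i j)%N = 2%N /\
  forall i j, P i -> P j -> e i j -> (i == a) && (j == b) || (i == b) && (j == a).
Proof.
move=> [esym eirr] Pa Pb eab; rewrite adjacency_sum_set; set S := [set p | _] => S4.
have ne x y : e x y -> x != y by apply: contraTneq => ->; rewrite eirr.
have inS x y : P x -> P y -> e x y -> (x, y) \in S by move=> Px Py xy; rewrite inE /= Px Py.
have unique i j : P i -> P j -> e i j -> (i == a) && (j == b) || (i == b) && (j == a).
  move=> Pi Pj eij; apply: contraTT S4 => ijN; rewrite -leqNgt.
  have uq : uniq [:: (a, b); (b, a); (i, j); (j, i)].
    rewrite /= !inE !xpair_eqE !(eq_sym a i) !(eq_sym a j) !(eq_sym b i) !(eq_sym b j).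
    move: ijN (ne a b eab) (ne i j eij); rewrite (eq_sym b a) (eq_sym j i).
    by case: (i == a); case: (i == b); case: (j == a); case: (j == b);
       case: (a == b); case: (i == j).
  have {uq} := card_uniqP uq; rewrite /= => <-; apply: subset_leq_card.
  apply/fintype.subsetP => q; rewrite !inE => /or4P[] /eqP->;
  by rewrite /= ?Pa ?Pb ?Pi ?Pj ?eab ?eij // esym ?eab ?eij.
split=> //; suff -> : S = [set (a, b); (b, a)].
  by rewrite cards2 xpair_eqE [b == a]eq_sym (negPf (ne a b eab)).
apply/setP => -[i j]; rewrite !inE /= !xpair_eqE; apply/idP/idP.
  by case/and3P; apply: unique.
by case/orP=> /andP[/eqP-> /eqP->]; rewrite Pa Pb ?eab // esym eab.
Qed.

(** Minimum degree two makes a triangle. Its size 3 is odd and below 9, so both parts of the theorem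
    concern graphs with at least four vertices. *)
Lemma gsize_3 {n : nat} {e : rel 'I_n} :
  simple_graph e -> two_connected e -> (n <= 3)%N -> gsize e = 3%N.
Proof.
move=> sg tc n3; have [esym eirr] := sg; have [n2 _ _] := tc.
have nE : n = 3%N by apply/eqP; rewrite eqn_leq n3.
move: e sg tc esym eirr; rewrite {}nE => e sg tc esym eirr {n n3 n2}.
have eE i j : e i j = (i != j).
  have [->|ij] := eqVneq i j; first by rewrite eirr.
  have [k] : exists k, k \notin [set i; j] by apply: exists_notin; rewrite cards2 ij.
  rewrite !inE negb_or => /andP[ki kj].
  have [z zk iz] := two_connected_neighbour i k tc (etrans (congr1 negb (eq_sym _ _)) ki).
  have zi : z != i by apply: contraTneq iz => ->; rewrite eirr.
  suff -> : j = z by [].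
  apply/val_inj; move: ij ki kj zk zi; rewrite -!val_eqE /=.
  move: (ltn_ord i) (ltn_ord j) (ltn_ord k) (ltn_ord z).
  move: (i : nat) (j : nat) (k : nat) (z : nat).
  clear; lia.
apply: double_inj; rewrite -(sum_adjacency sg).
under eq_bigr => i _ do under eq_bigr => j _ do rewrite eE.
by rewrite !big_ord_recl !big_ord0.
Qed.

Lemma unique_nonneighbour {n : nat} {e : rel 'I_n} (u w : 'I_n) :
  simple_graph e -> minimally_two_connected e -> (3 < n)%N ->
  w != u -> ~~ e u w -> (forall z, z != u -> ~~ e u z -> z = w) ->
  (forall b, e u b -> e w b) ->
  gsize e = (#|[set b | e u b]|).*2 /\ graph_iso e (K2 #|[set b | e u b]|).
Proof.
move=> sg mc n3 wu uw onlyw wB; have [esym eirr] := sg.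
have tf x y z := minimally_two_connected_triangle_free x y z sg mc n3.
split; last exact: (graph_iso_K2 u w).
have E0 : (\sum_(i | ~~ e u i) \sum_(j | ~~ e u j) e i j = 0)%N.
  have uN z : ~~ e u z -> z = u \/ z = w.
    by move=> uz; have [|zu] := eqVneq z u; [left | right; apply: onlyw].
  apply: big1 => i /uN ui; apply: big1 => j /uN uj.
  by case: ui => ->; case: uj => ->; rewrite ?eirr ?(negPf uw) // esym (negPf uw).
have := neighbour_degree_sum u sg tf; rewrite E0 addn0 => /double_inj <-.
rewrite (eq_bigr (fun=> 2%N)) => [|b ub]; last first.
  rewrite (bigD1 u) //= esym ub (bigD1 w) //= [e b w]esym wB // big1 // => z /andP[zu zw].
  have uz : e u z by apply: contraNT zw => /(onlyw _ zu) ->.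
  by rewrite (negPf (tf b u z _ uz)) // esym.
by rewrite sum_nat_const cardsE muln2.
Qed.

(** The chain [m <= l ^+ 2 <= m - e(W)] collapses: [W] is independent and [l ^+ 2 = m]. *)
Lemma even_extremal {R : realType} {n : nat} {e : rel 'I_n} {l : R} :
  simple_graph e -> minimally_two_connected e -> (3 < n)%N ->
  eigenvalue (adjmx R e) l -> Num.sqrt (gsize e)%:R <= l ->
  l = Num.sqrt (gsize e)%:R /\ graph_iso e (K2 (gsize e)./2).
Proof.
move=> sg mc n3 el lel; have [esym eirr] := sg; have [tc _] := mc.
have tf x y z := minimally_two_connected_triangle_free x y z sg mc n3.
have [x [u [xE xu x1]]] := eigenvector_normalized esym el.
have count := neighbour_degree_sum u sg tf.
have ld := eigenvalue_le_degree xE xu x1.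
have lS := eigenvalue_sqr_le xE xu x1.
have l0 : 0 <= l by apply: le_trans lel; apply: sqrtr_ge0.
have l2 : (gsize e)%:R <= l ^+ 2.
  by rewrite -[leLHS]sqr_sqrtr // ler_sqr ?nnegrE // sqrtr_ge0.
have mS : (gsize e <= \sum_(b | e u b) \sum_j e b j)%N.
  by rewrite -(ler_nat R) (le_trans l2).
have [SE E0] : (\sum_(b | e u b) \sum_j e b j = gsize e)%N /\
    (\sum_(i | ~~ e u i) \sum_(j | ~~ e u j) e i j = 0)%N.
  by move: count mS; rewrite -!addnn; lia.
have lE : l = Num.sqrt (gsize e)%:R.
  apply/eqP; rewrite eq_le lel andbT -(ler_sqr (R := R)) ?nnegrE ?sqrtr_ge0 //.
  by rewrite sqr_sqrtr // -SE.
split=> //.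
have indep i j : ~~ e u i -> ~~ e u j -> ~~ e i j.
  move=> ui uj; move/eqP: E0; rewrite sum_nat_eq0 => /forallP/(_ i)/implyP/(_ ui).
  by rewrite sum_nat_eq0 => /forallP/(_ j)/implyP/(_ uj); rewrite eqb0.
have [full uniq3] := independent_nonneighbours_complete u sg mc n3 indep.
have exN (a : 'I_n) : exists c, c != a.
  have [c] : exists c, c \notin [set a] by apply: exists_notin; rewrite cards1; apply: leq_trans n3.
  by rewrite inE; exists c.
have [c cu] := exN u; rewrite eq_sym in cu.
have [b bc ub] := two_connected_neighbour u c tc cu.
have bu : b != u by apply: contraTneq ub => ->; rewrite eirr.
have [w wu bw] := two_connected_neighbour b u tc bu.
have uw : ~~ e u w by apply: (tf u b).
have only z : z != u -> ~~ e u z -> z = w.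
  move=> zu uz; apply: contraTeq isT => zw; exfalso.
  suff d3 : (2 < #|[set b | e u b]|)%N.
    by move/eqP: zw; apply; apply: uniq3.
  (* With a second nonneighbour [z], each neighbour of [u] sees [u], [w] and [z], so
     [3 * deg u <= m]; and [m <= l ^+ 2 <= (deg u) ^ 2], whence [deg u >= 3]. *)
  have b3 : (#|[set b | e u b]| * 3 <= \sum_(b | e u b) \sum_j e b j)%N.
    rewrite cardsE -sum_nat_const; apply: leq_sum => a ua; have {}ua : e u a := ua.
    rewrite (bigD1 u) //= [e a u]esym ua (bigD1 w) //= [e a w]esym full //.
    by rewrite (bigD1 z) /= ?zu ?zw // [e a z]esym full.
  rewrite -(ltr_nat R); move: b3; rewrite SE -(ler_nat R) natrM.
  have d0 : 1 <= #|[set b | e u b]|%:R :> R.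
    by rewrite ler1n card_gt0; apply/set0Pn; exists b; rewrite inE.
  nra.
have [-> iso] := unique_nonneighbour u w sg mc n3 wu uw only (fun b => full w b wu uw).
by rewrite doubleK.
Qed.

Lemma hub_neighbour {n : nat} {e : rel 'I_n} (u w1 w2 b : 'I_n) :
  simple_graph e -> (forall x y z, e x y -> e y z -> ~~ e x z) ->
  ~~ e u w1 -> (forall w, w != u -> ~~ e u w -> (w == w1) || (w == w2)) ->
  e u b -> e w1 b -> ~~ e w2 b -> forall j, e b j = (j \in [set u; w1]).
Proof.
move=> [esym eirr] tf uw1 onlyw ub w1b w2b j; rewrite !inE.
have [->|ju] := eqVneq j u; first by rewrite esym.
have [->|jw1] := eqVneq j w1; first by rewrite esym.
apply/negbTE/negP => bj; have uj : ~~ e u j by apply: (tf u b).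
have := onlyw j ju uj; rewrite (negPf jw1) /= => /eqP jw2.
by rewrite -jw2 esym bj in w2b.
Qed.

(** A common neighbour [b] of [u] and [w1] has no other neighbour, so [l * x b = 1 + x w1].
    Multiplying the equation at [w1] by [l] eliminates these entries. *)
Lemma hub_eigen_equation {R : realType} {n : nat} {e : rel 'I_n} {l : R} {x} (u w1 w2 : 'I_n) :
  simple_graph e -> (forall x y z, e x y -> e y z -> ~~ e x z) ->
  eigenvector e l x -> x u = 1 -> w1 != u ->
  ~~ e u w1 -> ~~ e u w2 -> e w1 w2 ->
  (forall w, w != u -> ~~ e u w -> (w == w1) || (w == w2)) ->
  (forall b, e u b -> e w1 b -> ~~ e w2 b) ->
  l * (\sum_(b | e u b && e w1 b) x b) =
    #|[set b | e u b && e w1 b]|%:R * (1 + x w1) /\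
  l ^+ 2 * x w1 = l * x w2 + #|[set b | e u b && e w1 b]|%:R * (1 + x w1).
Proof.
move=> sg tf xE xu w1u uw1 uw2 w12 onlyw excl; have [esym eirr] := sg.
have sumE : l * (\sum_(b | e u b && e w1 b) x b) =
    #|[set b | e u b && e w1 b]|%:R * (1 + x w1).
  rewrite mulr_sumr (eq_bigr (fun=> 1 + x w1)) => [|b /andP[ub w1b]].
    by rewrite sumr_const cardsE mulr_natl.
  rewrite -xE (eq_bigl (mem [set u; w1])) => [|j]; last first.
    by rewrite (hub_neighbour u w1 w2 b) ?excl.
  by rewrite big_setU1 ?big_set1 ?xu // inE eq_sym.
split=> //; rewrite -sumE expr2 -mulrA -xE (bigD1 w2) //= mulrDr; congr (_ + _ * _).
apply: eq_bigl => j; have [->|jw2] := eqVneq j w2; first by rewrite andbF (negPf uw2).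
rewrite andbT andbC; case: (boolP (e w1 j)) => //= w1j; symmetry.
apply: contraT => uj; have ju : j != u by apply: contraTneq w1j => ->; rewrite esym.
have := onlyw j ju uj; rewrite (negPf jw2) orbF => /eqP jw1.
by rewrite jw1 eirr in w1j.
Qed.

Lemma odd_extremal {R : realType} {n : nat} {e : rel 'I_n} {l : R} :
  simple_graph e -> minimally_two_connected e -> (3 < n)%N ->
  odd (gsize e) -> (9 <= gsize e)%N ->
  eigenvalue (adjmx R e) l -> rho1star R (gsize e) <= l ->
  l = rho1star R (gsize e) /\ graph_iso e (SK2 (gsize e)./2).
Proof.
move=> sg mc n3 oddm m9 el; have [esym eirr] := sg; have [tc _] := mc.
have [] := @rho1starP R (gsize e); set m := gsize e in oddm m9 *.
set r := rho1star R m => r_root r_max rl.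
have tf x y z := minimally_two_connected_triangle_free x y z sg mc n3.
have [x [u [xE xu x1]]] := eigenvector_normalized esym el.
have count := neighbour_degree_sum u sg tf.
have ld := eigenvalue_le_degree xE xu x1.
have lS := eigenvalue_sqr_le xE xu x1.
have m9R : 9 <= m%:R :> R by rewrite ler_nat.
have r_fact : (r - 1) * (r ^+ 2 - (m%:R - 2)) = 1 by move: r_root; lra.
(* The cubic takes the value -1 at 1. *)
have r1 : 1 < r.
  rewrite lt_neqAle r_max ?andbT; last by lra.
  by apply/eqP => r1; move: r_fact; rewrite -r1; lra.
have r2 : m%:R - 2 < r ^+ 2 by nra.
have l2 : m%:R - 2 < l ^+ 2 by nra.
(* From [m >= 9] follows [l ^+ 2 > 7]; as [l <= deg u], the vertex [u] has at least three
   neighbours. *)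
have l_gt2 : 2 < l by nra.
have d3 : (2 < #|[set b | e u b]|)%N by rewrite -(ltr_nat R); lra.
(* [m - 2 < l ^+ 2 <= m - e(W)], so at most one edge lies in [W]. *)
have mS : (gsize e < \sum_(b | e u b) \sum_j e b j + 2)%N.
  by rewrite -(ltr_nat R) natrD -/m; lra.
have [[[w1 w2] /and3P[/= uw1 uw2 w12]] | no_edge] :=
    pselect (exists p, [&& ~~ e u p.1, ~~ e u p.2 & e p.1 p.2]); last first.
  (* Without an edge in [W] the graph has even size. *)
  have indep i j : ~~ e u i -> ~~ e u j -> ~~ e i j.
    by move=> ui uj; apply/negP => eij; apply: no_edge; exists (i, j); rewrite /= ui uj.
  have [full uniq3] := independent_nonneighbours_complete u sg mc n3 indep.
  have [b] : exists b, b \in [set b | e u b] by apply/card_gt0P; apply: leq_trans d3.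
  rewrite inE => ub; have bu : b != u by apply: contraTneq ub => ->; rewrite eirr.
  have [w wu bw] := two_connected_neighbour b u tc bu.
  have uw : ~~ e u w by apply: (tf u b).
  have [mE _] := unique_nonneighbour u w sg mc n3 wu uw
    (fun z zu uz => uniq3 d3 z w zu uz wu uw) (fun b => full w b wu uw).
  by move: oddm; rewrite /m mE odd_double.
have E4 : (\sum_(i | ~~ e u i) \sum_(j | ~~ e u j) e i j < 4)%N.
  rewrite -(ltn_add2l (\sum_(b | e u b) \sum_j e b j).*2) count -[4%N]/(2.*2)%N.
  by rewrite -doubleD ltn_double.
have [E2 single] := adjacency_sum_unique_edge sg uw1 uw2 w12 E4.
have [onlyw excl [b1 ub1 w1b1] [b2 ub2 w2b2]] :=
  single_edge_nonneighbours u w1 w2 sg mc n3 d3 uw1 uw2 w12 single.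
have w21 : e w2 w1 by rewrite esym.
have w1u : w1 != u by apply: contraTneq w12 => ->.
have w2u : w2 != u by apply: contraTneq w21 => ->.
have excl1 b : e u b -> e w1 b -> ~~ e w2 b by move=> ub; rewrite excl.
have excl2 b : e u b -> e w2 b -> ~~ e w1 b by move=> ub; rewrite excl // negbK.
have onlyw' w : w != u -> ~~ e u w -> (w == w2) || (w == w1) by rewrite orbC; apply: onlyw.
have [sum1 eq1] := hub_eigen_equation u w1 w2 sg tf xE xu w1u uw1 uw2 w12 onlyw excl1.
have [sum2 eq2] := hub_eigen_equation u w2 w1 sg tf xE xu w2u uw2 uw1 w21 onlyw' excl2.
set p := #|[set b | e u b && e w1 b]| in sum1 eq1.
set q := #|[set b | e u b && e w2 b]| in sum2 eq2.
have dE : #|[set b | e u b]| = (p + q)%N.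
  rewrite -(cardsID [set b | e w1 b]); congr (_ + _)%N; apply: eq_card => b; rewrite !inE //.
  by rewrite andbC; case: (boolP (e u b)) => // ub; rewrite excl // negbK.
have p0 : (0 < p)%N by apply/card_gt0P; exists b1; rewrite inE ub1.
have q0 : (0 < q)%N by apply/card_gt0P; exists b2; rewrite inE ub2.
(* Each neighbour of [u] has degree two, and [w1 w2] is the one further edge. *)
have mE : m = (p + q).*2.+1.
  have SE : (\sum_(b | e u b) \sum_j e b j = (p + q).*2)%N.
    rewrite -dE -muln2 cardsE -sum_nat_const; apply: eq_bigr => b ub.
    have {}ub : e u b := ub.
    have -> : (\sum_j e b j = #|[pred j | e b j]|)%N.
      by rewrite -sum1_card [RHS]big_mkcond; apply: eq_bigr => j _; rewrite inE; case: (e b j).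
    case: (boolP (e w1 b)) => w1b.
      rewrite (eq_card (B := [set u; w1])) ?cards2 1?eq_sym ?w1u // => j.
      by rewrite inE (hub_neighbour u w1 w2 b) ?excl1.
    have w2b : e w2 b by move: w1b; rewrite excl // negbK.
    rewrite (eq_card (B := [set u; w2])) ?cards2 1?eq_sym ?w2u // => j.
    by rewrite inE (hub_neighbour u w2 w1 b).
  by apply: double_inj; rewrite /m -count E2 SE doubleS addn2.
have eq0 : l ^+ 2 = p%:R * (1 + x w1) + q%:R * (1 + x w2).
  have := xE u; rewrite xu mulr1 expr2 => {2}<-.
  rewrite (bigID (e w1)) /= mulrDr sum1 -sum2; congr (_ + _ * _); apply: eq_bigl => b.
  by case: (boolP (e u b)) => // ub; rewrite excl // negbK.
have mR : m%:R - 2 = 2 * (p + q)%:R - 1 :> R.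
  by rewrite mE -addn1 -muln2 natrD natrM; ring.
rewrite mR in l2.
have [|f_le f_eq] := reduced_eigen_system (lt_trans (ltr0Sn R 1) l_gt2) p0 q0 _
  (x1 w1) (x1 w2) eq0 eq1 eq2 l2.
  by rewrite -dE.
(* [f_le] says that the cubic is nonpositive at [l]. *)
have lr : l = r.
  by apply/eqP; rewrite eq_le rl andbT; apply: r_max; move: f_le; rewrite -mR; lra.
split=> //; have {f_eq} : p = 1%N \/ q = 1%N by apply: f_eq; rewrite -mR lr.
have -> : m./2 = #|[set b | e u b]| by rewrite dE mE /= uphalf_double.
case=> [/eqP/cards1P[c cE] | /eqP/cards1P[c cE]].
  (* For [p = 1] the roles of [w1] and [w2] are exchanged. *)
  have cP b : (e u b && e w1 b) = (b == c) by move/setP/(_ b): cE; rewrite !inE.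
  have /andP[uc w1c] : e u c && e w1 c by rewrite cP.
  apply: (graph_iso_SK2 u w2 w1 c) => // b ub; last by rewrite -cP ub.
  by rewrite excl // negbK.
have cP b : (e u b && e w2 b) = (b == c) by move/setP/(_ b): cE; rewrite !inE.
have /andP[uc w2c] : e u c && e w2 c by rewrite cP.
by apply: (graph_iso_SK2 u w1 w2 c) => // b ub; rewrite -cP ub.
Qed.

Theorem theorem1p1 (R : realType) (n : nat) (e : rel 'I_n) :
  simple_graph e -> minimally_two_connected e ->
  let m := gsize e in
  (~~ odd m ->
     spec_rad R e <= Num.sqrt (m%:R : R) /\
     (spec_rad R e = Num.sqrt (m%:R : R) <-> graph_iso e (K2 m./2))) /\
  (odd m -> (9 <= m)%N ->
     spec_rad R e <= rho1star R m /\
     (spec_rad R e = rho1star R m <-> graph_iso e (SK2 m./2))).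
Proof.
move=> sg mc m; have [esym _] := sg; have [tc _] := mc.
have n3 : m != 3%N -> (3 < n)%N.
  by rewrite ltnNge; apply: contraNN => n3; rewrite /m gsize_3.
(* Makes the bound [Num.sqrt m%:R] positive, as [spec_rad_extremal] requires. *)
have m0 : (0 < m)%N.
  have [n2 _ _] := tc; pose u := Ordinal (ltnW (ltnW n2)); pose v := Ordinal (ltnW n2).
  have [z _ uz] := two_connected_neighbour u v tc isT.
  rewrite -double_gt0 -(sum_adjacency sg) (bigD1 u) //= addn_gt0 (bigD1 z) //= uz.
  by rewrite addn_gt0.
split=> [evenm | oddm m9].
  have {}n3 : (3 < n)%N by apply: n3; apply: contraNneq evenm => ->.
  apply: spec_rad_extremal => [|l el lel|iso].
  - by rewrite sqrtr_gt0 ltr0n.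
  - exact: even_extremal.
  have s2 : Num.sqrt (m%:R : R) ^+ 2 = (2 * m./2)%:R.
    by rewrite sqr_sqrtr // mul2n even_halfK.
  apply: (graph_iso_eigenvalue (i' := ord0) esym iso (eigenvector_K2 _ _ s2)) => /=.
  by rewrite gt_eqF // sqrtr_gt0 ltr0n.
have {}n3 : (3 < n)%N by apply: n3; apply: contraTneq m9 => ->.
have [r_root r_max] := @rho1starP R m.
have m9R : 9 <= m%:R :> R by rewrite ler_nat.
have r1 : 1 < rho1star R m.
  rewrite lt_neqAle r_max ?andbT; last by lra.
  by apply/eqP => r1; move: r_root; rewrite -r1; lra.
apply: spec_rad_extremal => [|l el lel|].
- exact: lt_trans ltr01 r1.
- exact: odd_extremal.
(* [eigenvector_SK2] is stated for [SK2 k.+1], hence the shift to [k = m./2 - 1]. *)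
have mE : m = (2 * (m./2).-1 + 3)%N by move: (odd_double_half m) m9; rewrite oddm -addnn; lia.
have kE : m./2 = (m./2).-1.+1 by rewrite prednK // half_gt0 (leq_trans _ m9).
rewrite kE => iso.
apply: (graph_iso_eigenvalue (i' := ord0) esym iso (eigenvector_SK2 _ _ _ mE r_root)).
by rewrite /= mulf_neq0 // gt_eqF // ?subr_gt0 // (lt_trans ltr01).
Qed.
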